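(* Let $A,B\subseteq\mathbb{R}^m$ be nonempty compact sets. Suppose that there exist a closed, convex, pointed and solid cone $C\subseteq(\operatorname{Int}\mathbb{R}^m_+)\cup\{0\}$ and elements $\ell,u_A,u_B\in\mathbb{R}^m$ such that $A\subseteq(\ell,u_A)_C$ and $B\subseteq(\ell,u_B)_C$. Then the following statements are equivalent: (i) $A\prec^u B$; (ii) $\operatorname{cl}\big((A-\mathbb{R}^m_+)^c\big)\cap[\ell,u_A]_C\ \prec^l\ \operatorname{cl}\big((B-\mathbb{R}^m_+)^c\big)\cap[\ell,u_B]_C$.
   Context: $\mathbb{R}^m_+$ is the nonnegative orthant; sums and differences of sets are Minkowski sums and differences; $\operatorname{Int}$, $\operatorname{cl}$ and $(\cdot)^c$ denote interior, closure and complement in $\mathbb{R}^m$. A set $C\subseteq\mathbb{R}^m$ is a cone if $\lambda\ge 0$ and $c\in C$ imply $\lambda c\in C$; it is pointed if $C\cap(-C)=\{0\}$ and solid if $\operatorname{Int}C\ne\emptyset$. For $y^1,y^2\in\mathbb{R}^m$: $[y^1,y^2]_C:=(\{y^1\}+C)\cap(\{y^2\}-\mathbb{R}^m_+)$ and $(y^1,y^2)_C:=(\{y^1\}+\operatorname{Int}C)\cap(\{y^2\}-\operatorname{Int}\mathbb{R}^m_+)$. For nonempty $X,Y\subseteq\mathbb{R}^m$: $X\prec^l Y$ means $Y\subseteq X+\operatorname{Int}\mathbb{R}^m_+$, and $X\prec^u Y$ means $X\subseteq Y-\operatorname{Int}\mathbb{R}^m_+$. *)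

(* Defs.v *)
From HB Require Import structures.
From mathcomp Require Import all_boot all_order all_algebra.
From mathcomp Require Import all_classical all_reals all_analysis.

Set Implicit Arguments.
Unset Strict Implicit.
Unset Printing Implicit Defensive.

Import Order.TTheory GRing.Theory Num.Theory.
Import numFieldNormedType.Exports.

Local Open Scope classical_set_scope.
Local Open Scope ring_scope.

Definition nonneg_orthant (R : realType) (m : nat) : set 'rV[R]_m :=
  [set x | forall i : 'I_m, 0 <= x ord0 i].

Definition minkowski_add (R : realType) (m : nat) (X Y : set 'rV[R]_m) :
    set 'rV[R]_m :=
  [set x + y | x in X & y in Y].

(* Not the set-theoretic difference, which is [X `\` Y]. *)
Definition minkowski_sub (R : realType) (m : nat) (X Y : set 'rV[R]_m) :
    set 'rV[R]_m :=
  [set x - y | x in X & y in Y].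

Definition is_cone (R : realType) (m : nat) (C : set 'rV[R]_m) : Prop :=
  forall (lambda : R) (c : 'rV[R]_m), 0 <= lambda -> C c -> C (lambda *: c).

Definition pointed_cone (R : realType) (m : nat) (C : set 'rV[R]_m) : Prop :=
  C `&` [set - c | c in C] = [set 0].

Definition solid (R : realType) (m : nat) (C : set 'rV[R]_m) : Prop :=
  interior C !=set0.

(* The lower end is taken with respect to [C], the upper end with respect to
   the nonnegative orthant. *)
Definition cone_itvcc (R : realType) (m : nat) (C : set 'rV[R]_m)
    (y1 y2 : 'rV[R]_m) : set 'rV[R]_m :=
  minkowski_add [set y1] C `&`
  minkowski_sub [set y2] (@nonneg_orthant R m).

Definition cone_itvoo (R : realType) (m : nat) (C : set 'rV[R]_m)
    (y1 y2 : 'rV[R]_m) : set 'rV[R]_m :=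
  minkowski_add [set y1] (interior C) `&`
  minkowski_sub [set y2] (interior (@nonneg_orthant R m)).

(* The two set relations are meant for nonempty sets; as plain inclusions they
   are also defined on the empty set. *)
Definition lower_less (R : realType) (m : nat) (X Y : set 'rV[R]_m) : Prop :=
  Y `<=` minkowski_add X (interior (@nonneg_orthant R m)).

Definition upper_less (R : realType) (m : nat) (X Y : set 'rV[R]_m) : Prop :=
  X `<=` minkowski_sub Y (interior (@nonneg_orthant R m)).

(* Main.v *)
Require Import Defs.
From HB Require Import structures.
From mathcomp Require Import all_boot all_order all_algebra.
From mathcomp Require Import all_classical all_reals all_analysis.
From mathcomp Require Import lra.

Set Implicit Arguments.
Unset Strict Implicit.
Unset Printing Implicit Defensive.

Import Order.TTheory GRing.Theory Num.Theory.
Import numFieldNormedType.Exports.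

Local Open Scope classical_set_scope.
Local Open Scope ring_scope.


(** Write [x << y] for the strict coordinatewise order, whose positive cone is
    the interior of the orthant. Then [A] is upper-less than [B] when every
    point of [A] is [<<] some point of [B]. The closed complement
    [cl ((B - orthant)^c)] consists of the points that are [<<] no point of
    [B], because the interior of [B - orthant] is [B - Int orthant]
    ([closure_compl_sub_orthantP]). So each section in the theorem is the set
    of [y] in [l + C] with [y <= u] that no point of the given set strictly
    dominates ([complement_sectionP]).

    The link between the two relations is the last point of a ray
    [l + t c], [c >> 0], that lies below the compact set [B]
    ([ray_exit]). The value [min_i (b_i - l_i) / c_i] is the largest [t] with
    [l + t c <= b]; it is continuous in [b], so it has a maximum [t] over [B].
    Then [l + t c] is below some point of [B] and strictly below none, which
    places it in the section of [B] as soon as [c] is in [C].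

    From the upper to the lower relation: a point [y] of the section of [B] is
    not [l], since [l << b] for every [b] in [B]; hence [c = y - l >> 0]. Let
    [x = l + t c] be the last point of this ray below [A], say [x <= a << b].
    If [t >= 1], then [y <= x << b], contrary to the choice of [y]; so [t < 1]
    and [x << y].

    From the lower to the upper relation: let [a] in [A] be strictly below no
    point of [B], and let [y = l + t (a - l)] be the last point of this ray
    below [B], say [y <= b]. If [t > 1], then [a << y <= b], which is excluded;
    so [y <= a]. The hypothesis gives [x << y] in the section of [A], and
    [x << a] contradicts the definition of that section. *)

(** * The coordinatewise orders and rays *)

Definition coord_le (R : realType) (m : nat) (x y : 'rV[R]_m) : Prop :=
  forall i, x ord0 i <= y ord0 i.

Definition coord_lt (R : realType) (m : nat) (x y : 'rV[R]_m) : Prop :=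
  forall i, x ord0 i < y ord0 i.

Section Orthant.
Context {R : realType} {m : nat}.
Implicit Types (x y b c l u : 'rV[R]_m) (A B C : set 'rV[R]_m).

Lemma coord_lt_le x y : coord_lt x y -> coord_le x y.
Proof. by move=> xy i; exact/ltW. Qed.

Lemma coord_le_trans y x z : coord_le x y -> coord_le y z -> coord_le x z.
Proof. by move=> xy yz i; exact: le_trans (xy i) (yz i). Qed.

Lemma coord_le_lt_trans y x z : coord_le x y -> coord_lt y z -> coord_lt x z.
Proof. by move=> xy yz i; exact: le_lt_trans (xy i) (yz i). Qed.

Lemma coord_lt_le_trans y x z : coord_lt x y -> coord_le y z -> coord_lt x z.
Proof. by move=> xy yz i; exact: lt_le_trans (xy i) (yz i). Qed.

Lemma ray_le l c (s t : R) : coord_lt 0 c -> s <= t ->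
  coord_le (l + s *: c) (l + t *: c).
Proof.
by move=> c0 st i; rewrite !mxE lerD2l ler_pM2r//; have := c0 i; rewrite mxE.
Qed.

Lemma ray_lt l c (s t : R) : coord_lt 0 c -> s < t ->
  coord_lt (l + s *: c) (l + t *: c).
Proof.
by move=> c0 st i; rewrite !mxE ltrD2l ltr_pM2r//; have := c0 i; rewrite mxE.
Qed.

(** * Interiors and Minkowski differences with the orthant *)

(** A neighbourhood leaves room for a small move in any chosen direction; used
    with the constant vectors [1] and [-1], it turns interior points into strict
    inequalities in all coordinates at once. *)
Lemma nbhs_shift (V : normedModType R) (B : set V) (x v : V) :
  nbhs x B -> exists2 e : R, 0 < e & B (x + e *: v).
Proof.
move=> Bx.
have cv : x + t *: v @[t --> (0 : R)] --> x.
  rewrite -[X in _ --> X]addr0 -(scale0r v).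
  by apply: cvgD; [exact: cvg_cst|apply: cvgZr_tmp; exact: cvg_id].
have nB : \forall t \near (0 : R)^'+, B (x + t *: v).
  exact: (cvg_at_right_filter cv).
near (0 : R)^'+ => e; exists e => //.
by near: e; exact: nB.
Unshelve. all: by end_near. Qed.

Lemma interior_orthant :
  interior (@nonneg_orthant R m) = [set x | coord_lt 0 x].
Proof.
rewrite eqEsubset; split => x.
  move/(nbhs_shift (const_mx (-1))) => [e e0 xe] i.
  have := xe i; rewrite !mxE; lra.
move=> x0.
have : nbhs x
    [set z : 'rV[R]_m | forall i, (0 : 'rV[R]_m) ord0 i < z ord0 i].
  apply: (filter_forall (nbhs_filter x)) => i.
  have /cvgr_gt := @coord_continuous R 1 m ord0 i x.
  by apply; exact: x0.
by apply: filterS => z z0 i; have := z0 i; rewrite mxE => /ltW.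
Qed.

Lemma sub_orthantP B y : minkowski_sub B (@nonneg_orthant R m) y <->
  exists2 b, B b & coord_le y b.
Proof.
split=> [[b Bb [p p0 <-]]|[b Bb yb]].
  by exists b => // i; rewrite !mxE gerBl.
exists b => //; exists (b - y); last by rewrite opprB addrC subrK.
by move=> i; rewrite !mxE subr_ge0.
Qed.

Lemma sub_interior_orthantP B y :
  minkowski_sub B (interior (@nonneg_orthant R m)) y <->
  exists2 b, B b & coord_lt y b.
Proof.
rewrite interior_orthant; split=> [[b Bb [p p0 <-]]|[b Bb yb]].
  by exists b => // i; have := p0 i; rewrite !mxE gtrBl.
exists b => //; exists (b - y); last by rewrite opprB addrC subrK.
by move=> i; rewrite !mxE subr_gt0.
Qed.

Lemma add_interior_orthantP B y :
  minkowski_add B (interior (@nonneg_orthant R m)) y <->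
  exists2 b, B b & coord_lt b y.
Proof.
rewrite interior_orthant; split=> [[b Bb [p p0 <-]]|[b Bb yb]].
  by exists b => // i; have := p0 i; rewrite !mxE ltrDl.
exists b => //; exists (y - b); last by rewrite addrC subrK.
by move=> i; rewrite !mxE subr_gt0.
Qed.

Lemma add_set1P C l y : minkowski_add [set l] C y <-> C (y - l).
Proof.
split=> [[_ -> [c Cc <-]]|Cyl]; first by rewrite addrC addKr.
by exists l => //; exists (y - l) => //; rewrite addrC subrK.
Qed.

(** The two inclusions have different reasons: a point that can be moved up
    by [e (1, ..., 1)] inside [B - orthant] is strictly below [B], and
    conversely [B - Int orthant] is a union of translates of an open set. *)
Lemma interior_sub_orthant B :
  interior (minkowski_sub B (@nonneg_orthant R m)) =
  minkowski_sub B (interior (@nonneg_orthant R m)).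
Proof.
rewrite eqEsubset; split => y.
  move/(nbhs_shift (const_mx 1)) => [e e0] /sub_orthantP[b Bb yeb].
  apply/sub_interior_orthantP; exists b => // i.
  have := yeb i; rewrite !mxE; lra.
move=> [b Bb [p p0 <-]].
have cb : continuous (fun z : 'rV[R]_m => b - z).
  by move=> z; apply: continuousB; [exact: cst_continuous|exact: cvg_id].
have : nbhs (b - (b - p)) (@nonneg_orthant R m) by rewrite subKr.
move/cb; apply: (@filterS _ _ (nbhs_filter (b - p))) => z bz0.
by exists b => //; exists (b - z) => //; rewrite subKr.
Qed.

Lemma closure_compl_sub_orthantP B y :
  closure (~` minkowski_sub B (@nonneg_orthant R m)) y <->
  forall b, B b -> ~ coord_lt y b.
Proof.
rewrite -[closure _]setCK -interiorC setCK interior_sub_orthant.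
split=> [h b Bb yb|h /sub_interior_orthantP[b Bb]]; last exact: h.
by apply: h; apply/sub_interior_orthantP; exists b.
Qed.

(** The order-theoretic form of the sections: closure and complement turn into
    the absence of strict domination. *)
Lemma complement_sectionP B C l u y :
  (closure (~` minkowski_sub B (@nonneg_orthant R m)) `&` cone_itvcc C l u) y
  <-> [/\ C (y - l), coord_le y u & forall b, B b -> ~ coord_lt y b].
Proof.
split=> [[/closure_compl_sub_orthantP h [/add_set1P Cy]]|[Cy yu h]].
  by move=> /sub_orthantP[_ ->].
split; first exact/closure_compl_sub_orthantP.
by split; [exact/add_set1P|apply/sub_orthantP; exists u].
Qed.

(** Only [c = 0] has to be excluded, and then [- e (1, ..., 1)] would lie in [C]
    for some [e > 0]. In dimension [0] the point [0] is interior. *)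
Lemma interior_cone_pos C c : (0 < m)%N ->
  C `<=` interior (@nonneg_orthant R m) `|` [set 0] ->
  interior C c -> coord_lt 0 c.
Proof.
move=> m0 subC Cc.
have [||c0] := subC c; [exact: interior_subset|by rewrite interior_orthant|].
have [e e0 Ce] := nbhs_shift (const_mx (-1)) Cc.
have := subC _ Ce; rewrite c0 add0r interior_orthant => -[/(_ (Ordinal m0))|].
  by rewrite !mxE; lra.
by move=> /rowP/(_ (Ordinal m0)); rewrite !mxE; lra.
Qed.

(** * The last point of a ray below a compact set *)

Lemma continuous_big_min (T : topologicalType) (I : Type) (r : seq I)
    (F0 : T -> R) (F : I -> T -> R) :
  continuous F0 -> (forall i, continuous (F i)) ->
  continuous (fun z => \big[Num.min/F0 z]_(i <- r) F i z).
Proof.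
move=> cF0 cF; elim: r => [|i r IHr] x.
  by under eq_fun do rewrite big_nil; exact: cF0.
under eq_fun do rewrite big_cons.
by apply: continuous_min; [exact: cF|exact: IHr].
Qed.

(** Given a ray that starts strictly below [B] in a positive direction, [t] is
    the largest parameter for which it is still below some point of [B]. *)
Lemma ray_exit B l c : (0 < m)%N -> B !=set0 -> compact B ->
  coord_lt 0 c -> (forall b, B b -> coord_lt l b) ->
  exists t b, [/\ 0 < t, B b, coord_le (l + t *: c) b &
    forall b', B b' -> ~ coord_lt (l + t *: c) b'].
Proof.
move=> m0 B0 cB c0 lB; pose i0 := Ordinal m0.
have ci i : 0 < c ord0 i by have := c0 i; rewrite mxE.
pose F (i : 'I_m) b := (b ord0 i - l ord0 i) / c ord0 i.
pose g b := \big[Num.min/F i0 b]_i F i b.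
(* [g b] is the largest parameter for which the ray is below [b]; starting the
   minimum at [F i0 b], one of its terms, leaves its value unchanged. *)
have g_ge t b : t <= g b <-> coord_le (l + t *: c) b.
  have tF i : (t <= F i b) = ((l + t *: c) ord0 i <= b ord0 i).
    by rewrite ler_pdivlMr// lerBrDl !mxE.
  split=> [/bigmin_geP[_ h] i|h]; first by rewrite -tF h.
  by apply/bigmin_geP; split=> [|i _]; rewrite tF.
have g_gt t b : t < g b <-> coord_lt (l + t *: c) b.
  have tF i : (t < F i b) = ((l + t *: c) ord0 i < b ord0 i).
    by rewrite ltr_pdivlMr// ltrBrDl !mxE.
  split=> [/bigmin_gtP[_ h] i|h]; first by rewrite -tF h.
  by apply/bigmin_gtP; split=> [|i _]; rewrite tF.
have cF i : continuous (F i).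
  have ch : continuous (fun r : R => (r - l ord0 i) / c ord0 i).
    by move=> r; apply: cvgMr_tmp; apply: cvgB; [exact: cvg_id|exact: cvg_cst].
  move=> x; apply: (continuous_comp _ (ch _)); exact: coord_continuous.
have cg : continuous g by exact: continuous_big_min.
have [b] := compact_EVT_max B0 cB (continuous_subspaceT cg).
rewrite inE => Bb gmax; exists (g b), b; split=> //.
- by apply/g_gt; rewrite scale0r addr0; exact: lB.
- exact/g_ge.
- by move=> b' Bb' /g_gt; apply/negP; rewrite -leNgt gmax// inE.
Qed.

End Orthant.

(** * The equivalence *)

Theorem theorem3p5 (R : realType) (m : nat) (A B : set 'rV[R]_m)
  (A0 : A !=set0) (B0 : B !=set0) (cA : compact A) (cB : compact B)
  (C : set 'rV[R]_m) (l uA uB : 'rV[R]_m)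
  (clC : closed C) (convC : convex_set C) (coneC : is_cone C)
  (pointedC : pointed_cone C) (solidC : solid C)
  (subC : C `<=` interior (@nonneg_orthant R m) `|` [set 0])
  (subA : A `<=` cone_itvoo C l uA) (subB : B `<=` cone_itvoo C l uB) :
  upper_less A B <->
  lower_less
    (closure (~` minkowski_sub A (@nonneg_orthant R m)) `&` cone_itvcc C l uA)
    (closure (~` minkowski_sub B (@nonneg_orthant R m)) `&` cone_itvcc C l uB).
Proof.
(* In dimension [0] any point is strictly below any other, so the first
   relation holds and both sections are empty. *)
have [m0|m0] := posnP m.
  subst m; split=> _ y; rewrite ?complement_sectionP.
    by case: B0 => b Bb [_ _ /(_ b Bb)[]] [].
  by case: B0 => b Bb _; apply/sub_interior_orthantP; exists b => // -[].
have cone_pos x : C x -> x = 0 \/ coord_lt 0 x.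
  by move=> /subC[|]; [rewrite interior_orthant; right|left].
have below D u : D `<=` cone_itvoo C l u -> forall d, D d ->
    [/\ C (d - l), coord_lt 0 (d - l), coord_lt l d & coord_lt d u].
  move=> sD d /sD[/add_set1P Cd /sub_interior_orthantP[_ -> du]].
  have d0 := interior_cone_pos m0 subC Cd.
  split=> //; first exact: interior_subset.
  by move=> i; have := d0 i; rewrite !mxE subr_gt0.
have exit D u c : D !=set0 -> compact D -> D `<=` cone_itvoo C l u ->
    C c -> coord_lt 0 c -> exists t d, [/\ D d, coord_le (l + t *: c) d &
    (closure (~` minkowski_sub D (@nonneg_orthant R m)) `&` cone_itvcc C l u)
      (l + t *: c)].
  move=> D0 cD sD Cc c0; have lD d : D d -> coord_lt l d by case/(below _ _ sD).
  have [t [d [t0 Dd tcd h]]] := ray_exit m0 D0 cD c0 lD.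
  exists t, d; split=> //; apply/complement_sectionP; split=> //.
    by rewrite addrC addKr; apply: coneC => //; exact: ltW.
  by have [_ _ _ /coord_lt_le] := below _ _ sD _ Dd; exact: coord_le_trans.
(* [z] is the point of parameter [1] on the ray from [l] through [z], so it is
   compared with the exit point through the parameters. *)
have ray1 z : l + 1 *: (z - l) = z by rewrite scale1r addrC subrK.
split=> [AB y /complement_sectionP[Cy yuB yB]|AB a Aa].
  have [/eqP|c0] := cone_pos _ Cy.
    rewrite subr_eq0 => /eqP yl; case: B0 => b Bb.
    by have [_ _ lb _] := below _ _ subB b Bb; case: (yB b Bb); rewrite yl.
  have [t [a [Aa ta Sx]]] := exit _ _ _ A0 cA subA Cy c0.
  apply/add_interior_orthantP; exists (l + t *: (y - l)) => //.
  rewrite -[X in coord_lt _ X]ray1; apply: ray_lt => //.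
  rewrite ltNge; apply/negP => t1.
  have /sub_interior_orthantP[b Bb ab] := AB _ Aa.
  apply: (yB b Bb); rewrite -(ray1 y).
  apply: coord_le_lt_trans (ray_le l c0 t1) _.
  exact: coord_le_lt_trans ta ab.
apply: contrapT => naB.
have {}naB b : B b -> ~ coord_lt a b.
  by move=> Bb ab; apply: naB; apply/sub_interior_orthantP; exists b.
have [Ca c0 _ _] := below _ _ subA a Aa.
have [t [b [Bb tb Sy]]] := exit _ _ _ B0 cB subB Ca c0.
have /add_interior_orthantP[x /complement_sectionP[_ _ xA] xy] := AB _ Sy.
apply: (xA a Aa); apply: coord_lt_le_trans xy _.
rewrite -[X in coord_le _ X]ray1; apply: ray_le => //.
rewrite leNgt; apply/negP => t1.
apply: (naB b Bb); rewrite -(ray1 a).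
exact: coord_lt_le_trans (ray_lt l c0 t1) tb.
Qed.
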